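(* Let $q=p^r$ with $p$ prime and let $a,b\in\mathbb F_q^*$. Let $c=ba^{-3}$ and let $\mathcal X$ be the projective plane curve over $\mathbb F_q$ defined by (the homogenization of) $y^2+cy+xy=x^3$. Then $N_3(a,b)=|\mathcal X(\mathbb F_q)|$ and \[ P_3(a,b)=\tfrac13\bigl(|\mathcal X(\mathbb F_q)|-\epsilon\bigr), \] where $\epsilon=1$ if $p\ne3$ and $c=\frac1{27}$, and $\epsilon=0$ otherwise.
   Context: $N_3(a,b)$ is the number of $x\in\mathbb F_{q^3}^*$ with $\operatorname{Tr}_{\mathbb F_{q^3}/\mathbb F_q}(x)=a$ and $\operatorname{N}_{\mathbb F_{q^3}/\mathbb F_q}(x)=b$. $P_3(a,b)$ is the number of irreducible polynomials $x^3-ax^2+ux-b$ ($u\in\mathbb F_q$) in $\mathbb F_q[x]$. $\mathcal X(\mathbb F_q)$ is the set of $\mathbb F_q$-rational points of $\mathcal X$ (including points at infinity). *)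

(* Defs.v *)
From HB Require Import structures.
From mathcomp Require Import all_boot all_order all_fingroup all_algebra all_field.

Set Implicit Arguments.
Unset Strict Implicit.
Unset Printing Implicit Defensive.

Import GRing.Theory.
Local Open Scope ring_scope.

(* galTrace and galNorm take values in L, hence the embeddings a%:A, b%:A; the
   alias finvect_type L equips L with its finite and splitting field structures. *)
Definition N3 (F : finFieldType) (L : fieldExtType F) (a b : F) : nat :=
  #|[set x : finvect_type L |
      [&& x != 0,
          galTrace 1%VS {:finvect_type L} x == a%:A
        & galNorm 1%VS {:finvect_type L} x == b%:A]]|.

Definition cubic (F : finFieldType) (a b u : F) : {poly F} :=
  'X^3 - a *: 'X^2 + u *: 'X - b%:P.

(* {poly_4 F} is the finite type of polynomials of degree at most 3. *)
Definition P3 (F : finFieldType) (a b : F) : nat :=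
  #|[set f : {poly_4 F} |
      irreducibleb (f : {poly F}) &&
      [exists u : F, (f : {poly F}) == cubic a b u]]|.

(* v and w are homogeneous coordinates of the same point of P^2(F). *)
Definition proportional (F : finFieldType) (v w : 'rV[F]_3) : bool :=
  [exists k : F, (k != 0) && (w == k *: v)].

Definition on_curve (F : finFieldType) (c : F) (v : 'rV[F]_3) : bool :=
  let x := v 0 0 in let y := v 0 1 in let z := v 0 2 in
  y ^+ 2 * z + c * y * z ^+ 2 + x * y * z == x ^+ 3.

(* Points of P^2(F) are the classes of nonzero vectors up to scaling; on_curve
   is homogeneous, so it is constant on each class. *)
Definition curve_points (F : finFieldType) (c : F) : {set {set 'rV[F]_3}} :=
  equivalence_partition (@proportional F) [set v | (v != 0) && on_curve c v].

(* Main.v *)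
Require Import Defs.
From mathcomp Require Import all_boot all_order all_fingroup all_algebra all_field.
From mathcomp Require Import ring zify.

(** Fix [a] and [b] and sort the cubics [X^3 - a X^2 + u X - b] over [F] by [u].
    Each nonzero [x] in [F] is a root of exactly one of them, so the numbers of
    roots add up to [q - 1]; the ordered factorizations into linear factors add
    up to the number of triples with sum [a] and product [b]. Comparing the two
    sums cubic by cubic gives
      3 (number of irreducible cubics) + (number of cubics (X - x)^3)
        = (number of triples) + 3,
    which replaces the Hasse-Davenport relation by an elementary count. In [L]
    each irreducible cubic has three distinct roots, whence the left side is
    [N3]. On the curve, [x = k a], [y = - k s], [z = - k t / c] turns
    [y z (y + c z + x) = x^3] into [(a - s - t) s t = b], so the points with
    [x != 0] are the triples, and three points have [x = 0]. *)

Set Implicit Arguments.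
Unset Strict Implicit.
Unset Printing Implicit Defensive.

Import GRing.Theory.
Local Open Scope ring_scope.

(** * Counting finite sets *)

Lemma sum_card_fibers (T J : finType) (P : pred T) (f : T -> J) :
  (\sum_j #|[set x | P x && (f x == j)]| = #|[set x | P x]|)%N.
Proof.
rewrite -sum1_card (partition_big f xpredT) //=; apply: eq_bigr => j _.
by rewrite -sum1_card; apply: eq_bigl => x; rewrite !inE.
Qed.

Lemma card_set_seq (T : finType) (s : seq T) :
  #|[set x in s]| = size (undup s).
Proof.
rewrite cardsE -(eq_card (mem_undup s)).
exact/card_uniqP/undup_uniq.
Qed.

(** * Roots and factorizations of a single cubic *)

Section CubicCount.

Variables (F : finFieldType) (a b : F).

Lemma root_cubic u x :
  root (cubic a b u) x = (x ^+ 3 - a * x ^+ 2 + u * x - b == 0).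
Proof. by rewrite /root /cubic !hornerE. Qed.

(** [(s, t)] encodes the ordered roots [s], [t], [a - s - t]; the [X^2] coefficient forces the
    third, leaving the constant and linear coefficients to match. *)
Definition factorizations (u : F) : {set F * F} :=
  [set t | ((a - t.1 - t.2) * t.1 * t.2 == b)
           && (t.1 * t.2 + (a - t.1 - t.2) * (t.1 + t.2) == u)].

(** The coefficients of [(X - x)^3], compared without dividing by 3. *)
Definition triple_roots (u : F) : {set F} :=
  [set x | (3%:R * x == a) && (x ^+ 3 == b) && (3%:R * x ^+ 2 == u)].

Lemma factorization_root u x y :
  (x, y) \in factorizations u ->
  [/\ root (cubic a b u) x, root (cubic a b u) y
    & root (cubic a b u) (a - x - y)].
Proof.
rewrite inE !root_cubic /= => /andP[/eqP<- /eqP<-].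
by split; apply/eqP; ring.
Qed.

(** Unique factorization: all ordered factorizations are rearrangements of one. The list has
    repetitions when roots coincide. *)
Lemma factorizationsE u x y z :
  z = a - x - y -> (x, y) \in factorizations u ->
  factorizations u =
    [set t in [:: (x, y); (x, z); (y, x); (y, z); (z, x); (z, y)]].
Proof.
move=> -> xyP; have := xyP; rewrite inE /= => /andP[/eqP bE /eqP uE].
apply/setP => -[s t]; rewrite 6!inE /= !inE !xpair_eqE.
apply/idP/idP; last first.
  by do ![case/orP]; case/andP=> /eqP-> /eqP->; rewrite -bE -uE;
    apply/andP; split; apply/eqP; ring.
move=> /andP[/eqP stb /eqP stu].
have rs : (s - x) * (s - y) * (s - (a - x - y)) = 0.
  have -> : (s - x) * (s - y) * (s - (a - x - y)) =
    s ^+ 3 - a * s ^+ 2 + (x * y + (a - x - y) * (x + y)) * s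
    - (a - x - y) * x * y by ring.
  by rewrite uE bE -stu -stb; ring.
(* With [s = v], the difference of the two linear coefficients is [(t - w) (t - (a - v - w))] up to
   sign. *)
have rt : forall v w, s = v -> v * w + (a - v - w) * (v + w) = u ->
    (t == w) || (t == a - v - w).
  move=> v w sv; rewrite -stu sv => /eqP; rewrite -subr_eq0 => /eqP vw.
  rewrite -subr_eq0 -[in X in _ || X]subr_eq0 -mulf_eq0 -vw.
  by apply/eqP; ring.
move/eqP: rs; rewrite !mulf_eq0 !subr_eq0.
case/orP => [/orP[]|] /eqP sE.
- by case/orP: (rt x y sE uE) => ->; rewrite sE eqxx ?orbT.
- have uE' : y * x + (a - y - x) * (y + x) = u by rewrite -uE; ring.
  case/orP: (rt y x sE uE') => /eqP ->; rewrite sE !eqxx ?orbT //.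
  by rewrite [a - y - x](_ : _ = a - x - y) ?eqxx ?orbT //; ring.
have uE' : (a - x - y) * x + (a - (a - x - y) - x) * ((a - x - y) + x) = u.
  by rewrite -uE; ring.
case/orP: (rt _ x sE uE') => /eqP ->; rewrite sE !eqxx ?orbT //.
by rewrite [a - _ - x](_ : _ = y) ?eqxx ?orbT //; ring.
Qed.

Lemma roots_factorization u x y z :
  z = a - x - y -> (x, y) \in factorizations u ->
  [set r | root (cubic a b u) r] = [set r in [:: x; y; z]].
Proof.
move=> ->; rewrite inE /= => /andP[/eqP bE /eqP uE]; apply/setP => r.
rewrite !inE root_cubic -uE -bE -(subr_eq0 r x) -(subr_eq0 r y).
rewrite -(subr_eq0 r (a - x - y)) -!mulf_eq0; congr (_ == 0); ring.
Qed.

(** Subtracting the two root equations and cancelling [x - y] gives the linear coefficient; one root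
    equation then gives the constant one. *)
Lemma distinct_roots_factorization u x y :
  x != y -> root (cubic a b u) x -> root (cubic a b u) y ->
  (x, y) \in factorizations u.
Proof.
rewrite -subr_eq0 !root_cubic => xy /eqP fx /eqP fy.
have uE : x * y + (a - x - y) * (x + y) = u.
  apply: (mulfI xy); apply/eqP; rewrite eq_sym -subr_eq0 -[X in _ == X]subr0.
  by rewrite -{1}fx -[X in _ == _ - X]fy; apply/eqP; ring.
rewrite inE /= uE eqxx andbT -subr_eq0 -[X in _ == X]fx -uE.
by apply/eqP; ring.
Qed.

Lemma triple_root_factorization u r :
  r \in triple_roots u -> (r, r) \in factorizations u.
Proof.
rewrite !inE /= => /andP[/andP[/eqP<- /eqP<-] /eqP<-].
by apply/andP; split; apply/eqP; ring.
Qed.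

(** The cubic takes the value [(x - r)^3] at [x]. *)
Lemma triple_root_unique u r x :
  r \in triple_roots u -> root (cubic a b u) x -> x = r.
Proof.
rewrite inE root_cubic => /andP[/andP[/eqP<- /eqP<-] /eqP<-] fx.
apply/eqP; rewrite -subr_eq0 -[_ == 0](expf_eq0 _ 3) -(eqP fx).
by apply/eqP; ring.
Qed.

Lemma triple_roots_eq u x y z :
  z = a - x - y -> (x, y) \in factorizations u ->
  triple_roots u = if (x == y) && (y == z) then [set x] else set0.
Proof.
move=> zE xyP; have [rx ry rz] := factorization_root xyP.
rewrite -zE in rz; apply/setP=> r; apply/idP/idP => [rP|].
  have rE v := @triple_root_unique u r v rP.
  by rewrite (rE x rx) (rE y ry) (rE z rz) !eqxx inE.
case: ifP; rewrite !inE // => /andP[/eqP xy /eqP yz] /eqP ->.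
move: xyP; rewrite inE /= -xy.
have xE : x = a - x - x by rewrite {1}xy yz zE -xy.
have -> : 3%:R * x = a by rewrite -(subrK x a) -(subrK x (a - x)) -xE; ring.
rewrite -xE.
move=> /andP[/eqP<- /eqP<-]; rewrite eqxx /=.
by apply/andP; split; apply/eqP; ring.
Qed.

(* Each factorization type of the cubic contributes equally to both sides:
   irreducible 3 + 0 + 0 = 3 + 0, linear times irreducible quadratic
   0 + 3 + 0 = 3 + 0, distinct roots 0 + 9 + 0 = 3 + 6, one double root
   0 + 6 + 0 = 3 + 3, triple root 0 + 3 + 1 = 3 + 1. *)
Lemma card_roots_factorizations u :
  (let n := #|[set x | root (cubic a b u) x]| in
   3 * (n == 0) + 3 * n + #|triple_roots u| = 3 + #|factorizations u|)%N.
Proof.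
case: (set_0Vmem (factorizations u)) => [f0 | [[x y] xyP]] /=.
  have -> : triple_roots u = set0.
    apply/setP=> r; rewrite in_set0; apply/negP => /triple_root_factorization.
    by rewrite f0 in_set0.
  rewrite f0 !cards0.
  (* For [n] equal to 0 or 1 the left side is 3. Two distinct roots would give a factorization. *)
  suff: (#|[set x | root (cubic a b u) x]| <= 1)%N by case: #|_| => [|[]].
  apply/card_le1_eqP => x y; rewrite !inE => rx ry; apply/eqP.
  apply: contraT => xy.
  by have := distinct_roots_factorization xy ry rx; rewrite f0 in_set0.
have [z zE] : exists z, z = a - x - y by exists (a - x - y).
rewrite (factorizationsE zE xyP) (roots_factorization zE xyP).
rewrite (triple_roots_eq zE xyP) !card_set_seq /= !inE !xpair_eqE.
rewrite (eq_sym z x) !eqxx.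
have [->|xy] := eqVneq x y; have [yz|yz] := eqVneq y z.
- by rewrite /= cards1.
- by rewrite /= cards0.
- by move: xy; rewrite yz => /negPf-> /=; rewrite cards0.
by have [xz|xz] := eqVneq x z; rewrite /= cards0.
Qed.

(** * Summation over the family of cubics *)

Definition split_pairs : {set F * F} :=
  [set t | (a - t.1 - t.2) * t.1 * t.2 == b].

(** The [x] for which [(X - x)^3] is in the family; also the scalars of trace [a] and norm [b] in a
    cubic extension. *)
Definition scalar_cube_roots : {set F} :=
  [set x | (3%:R * x == a) && (x ^+ 3 == b)].

Definition irreducible_cubics : {set F} :=
  [set u | [set x | root (cubic a b u) x] == set0].

(** Summing [card_roots_factorizations] over [u], with [q] the order of [F], the [3 (q - 1)] from
    roots cancels against [3 q] up to the constant 3. *)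
Lemma card_irreducible_cubics :
  b != 0 ->
  (3 * #|irreducible_cubics| + #|scalar_cube_roots|
   = #|split_pairs| + 3)%N.
Proof.
move=> b0.
have roots_sum : (\sum_u #|[set x | root (cubic a b u) x]| = #|F|.-1)%N.
  rewrite -(cardC1 0) -cardsE.
  (* Solving the root equation for [u] gives this function of a nonzero [x]; 0 is never a root since
     [b != 0]. *)
  rewrite -(sum_card_fibers _ (fun x => (b + a * x ^+ 2 - x ^+ 3) / x)).
  apply: eq_bigr => u _; apply: eq_card => x; rewrite !inE root_cubic.
  have [->|x0] /= := eqVneq x 0.
    by rewrite !expr0n !mulr0 subrr !add0r oppr_eq0 (negPf b0).
  rewrite -[RHS](inj_eq (mulIf x0)) divfK // -[RHS]subr_eq0 -[RHS]oppr_eq0.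
  by congr (_ == 0); ring.
have := erefl (\sum_u (3 + #|factorizations u|))%N.
rewrite -{1}(eq_bigr _ (fun u _ => card_roots_factorizations u)) /=.
have -> : #|irreducible_cubics|
    = (\sum_u (#|[set x | root (cubic a b u) x]| == 0))%N.
  rewrite -sum1_card big_mkcond /=; apply: eq_bigr => u _.
  by rewrite inE cards_eq0; case: (_ == set0).
rewrite !big_split /= !big1_eq roots_sum sum_nat_const.
rewrite (sum_card_fibers _ (fun x => 3%:R * x ^+ 2)) -/scalar_cube_roots.
rewrite (sum_card_fibers _
  (fun t => t.1 * t.2 + (a - t.1 - t.2) * (t.1 + t.2))) -/split_pairs.
(* [lia] needs [q > 1] because the predecessor [q.-1] is truncated. *)
move: (\sum_u _)%N (finNzRing_gt1 F) => irr; rewrite (_ : #|xpredT| = #|F|) //.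
by move: #|F| #|scalar_cube_roots| #|split_pairs| => q s t; lia.
Qed.

(** * Irreducible cubics, [P3] and the correction term *)

Lemma cubicE u : cubic a b u = Poly [:: - b; u; - a; 1].
Proof.
apply/polyP=> i; rewrite /cubic !(coefD, coefN, coefZ, coefXn, coefX, coefC).
by rewrite coef_Poly; case: i => [|[|[|[|i]]]] /=; rewrite ?nth_nil; ring.
Qed.

Lemma size_cubic u : size (cubic a b u) = 4%N.
Proof. by rewrite cubicE (@PolyK _ 0) //= oner_eq0. Qed.

Lemma cubic_monic u : cubic a b u \is monic.
Proof.
by rewrite monicE lead_coefE size_cubic cubicE (@PolyK _ 0) //= oner_eq0.
Qed.

Lemma cubic_inj : injective (cubic a b).
Proof.
move=> u v /(congr1 (fun p : {poly F} => p`_1)).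
by rewrite !cubicE !coef_Poly.
Qed.

(** In degree 3 a proper factorization contains a linear factor, hence a root. *)
Lemma irreducible_cubicP u :
  reflect (irreducible_poly (cubic a b u)) (u \in irreducible_cubics).
Proof.
rewrite inE; apply: (iffP eqP) => [/setP no_root | irr].
  apply: cubic_irreducible; first by rewrite size_cubic.
  by move=> x; have := no_root x; rewrite !inE => ->.
apply/setP=> x; rewrite !inE; rewrite root_factor_theorem.
apply/negP=> xf.
have [_ /(_ _ _ xf)] := irr; rewrite size_XsubC => /(_ isT)/eqp_size.
by rewrite size_XsubC size_cubic.
Qed.

Lemma P3E : P3 a b = #|irreducible_cubics|.
Proof.
pose h u := npolyp 4 (cubic a b u).
have hE u : h u = cubic a b u :> {poly F} by rewrite npolypK ?size_cubic.
rewrite -(@card_imset _ _ h); last first.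
  by move=> u v /(congr1 (@polyn _ _)); rewrite !hE => /cubic_inj.
apply: eq_card => f; rewrite inE; apply/andP/imsetP.
  case=> /irreducibleP irr /existsP[u /eqP fE]; exists u.
    by apply/irreducible_cubicP; rewrite -fE.
  by apply/val_inj; rewrite /= fE -hE.
case=> u /irreducible_cubicP irr ->; rewrite hE; split.
  exact/irreducibleP.
by apply/existsP; exists u.
Qed.

(** In characteristic 3, [3 x = 0] is never [a]. Otherwise [x = a / 3] is forced, and
    [(a / 3)^3 = b] is the condition on [c]. *)
Lemma card_scalar_cube_roots p r :
  prime p -> #|F| = (p ^ r)%N -> a != 0 ->
  #|scalar_cube_roots|
  = if (p != 3%N) && (b * a ^- 3 == 27%:R^-1) then 1%N else 0%N.
Proof.
move=> p_pr oF a0; have pF : p \in [pchar F] := card_finPcharP oF p_pr.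
have three0 : (3%:R == 0 :> F) = (p == 3%N).
  by rewrite -(dvdn_pcharf pF) dvdn_prime2.
have [p3|p3] /= := eqVneq p 3%N.
  apply/eqP; rewrite cards_eq0; apply/eqP/setP=> x; rewrite !inE.
  have /eqP-> : 3%:R == 0 :> F by rewrite three0 p3.
  by rewrite mul0r eq_sym (negPf a0).
have n3 : 3%:R != 0 :> F by rewrite three0.
have n27 : 27%:R != 0 :> F by rewrite (natrX F 3 3) expf_neq0.
have E : (b * a ^- 3 == 27%:R^-1) = ((a / 3%:R) ^+ 3 == b).
  rewrite expr_div_n -natrX -[RHS](inj_eq (mulIf n27)) divfK // eq_sym.
  rewrite -[LHS](inj_eq (mulIf n27)) mulVf // mulrAC.
  rewrite -[LHS](inj_eq (mulIf (expf_neq0 3 a0))) divfK ?expf_neq0 // mul1r.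
  by [].
rewrite E; case: ifP => [/eqP bE|nE].
  rewrite (_ : scalar_cube_roots = [set a / 3%:R]) ?cards1 //.
  apply/setP=> x; rewrite !inE -[RHS](inj_eq (mulfI n3)).
  rewrite [_ * (a / _)]mulrC divfK //.
  by apply: andb_idr => /eqP xE; rewrite -bE -xE mulrC mulKf.
apply/eqP; rewrite cards_eq0; apply/eqP/setP=> x; rewrite !inE.
apply/negP=> /andP[/eqP xE].
by move: nE; rewrite -xE mulrC mulKf // => ->.
Qed.

End CubicCount.

(** * Points of the projective curve, counted by representatives *)

Lemma card_equivalence_partition (T : finType) (R : rel T) (D W : {set T}) :
  equivalence_rel R -> W \subset D ->
  {in D, forall v, exists2 w, w \in W & R v w} ->
  {in W &, forall v w, R v w -> v = w} ->
  #|equivalence_partition R D| = #|W|.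
Proof.
move=> eqR /subsetP sWD covW injW.
have -> : equivalence_partition R D = [set [set y in D | R x y] | x in W].
  apply/setP=> B; apply/imsetP/imsetP=> -[x xD ->]; last by exists x; auto.
  have [w wW xw] := covW x xD; exists w => //.
  by apply/setP=> y; rewrite !inE ((eqR x w y).2 xw).
apply: card_in_imset => v w vW wW /setP/(_ w); rewrite !inE sWD //=.
by rewrite (eqR w w w).1 => /injW; apply.
Qed.

Lemma proportional_equivalence (F : finFieldType) :
  equivalence_rel (@proportional F).
Proof.
have sym (v w : 'rV[F]_3) : proportional v w -> proportional w v.
  case/existsP=> k /andP[k0 /eqP->]; apply/existsP; exists k^-1.
  by rewrite invr_eq0 k0 scalerA mulVf ?scale1r /=.
have trans (u v w : 'rV[F]_3) :
    proportional u v -> proportional v w -> proportional u w.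
  case/existsP=> k /andP[k0 /eqP->] /existsP[l /andP[l0 /eqP->]].
  by apply/existsP; exists (l * k); rewrite mulf_neq0 //= scalerA.
move=> u v w; split.
  by apply/existsP; exists 1; rewrite oner_neq0 scale1r /=.
by move=> uv; apply/idP/idP; apply: trans => //; apply: sym.
Qed.

Section CurveCount.

Variables (F : finFieldType) (a b c : F).
Hypotheses (a0 : a != 0) (c0 : c != 0) (cE : b = c * a ^+ 3).

Definition vec3 (x y z : F) : 'rV[F]_3 := \row_j [:: x; y; z]`_j.

Lemma vec3E x y z :
  [/\ vec3 x y z 0 0 = x, vec3 x y z 0 1 = y & vec3 x y z 0 2 = z].
Proof. by rewrite !mxE. Qed.

Lemma vec3_inj x y z x' y' z' :
  vec3 x y z = vec3 x' y' z' -> [/\ x = x', y = y' & z = z'].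
Proof.
have [xE yE zE] := vec3E x y z; have [xE' yE' zE'] := vec3E x' y' z'.
by move=> E; rewrite E in xE yE zE; split; congruence.
Qed.

Lemma vec3_eta (v : 'rV[F]_3) : v = vec3 (v 0 0) (v 0 1) (v 0 2).
Proof.
apply/rowP=> -[[|[|[|m]]] i] //; rewrite mxE /=;
  by congr (v _ _); apply/val_inj.
Qed.

Lemma scale_vec3 k x y z : k *: vec3 x y z = vec3 (k * x) (k * y) (k * z).
Proof. by apply/rowP=> -[[|[|[|m]]] i] //; rewrite !mxE. Qed.

Lemma vec3_eq0 x y z : (vec3 x y z == 0) = [&& x == 0, y == 0 & z == 0].
Proof.
apply/eqP/and3P => [E|[/eqP-> /eqP-> /eqP->]].
  by have [] := vec3E x y z; rewrite E !mxE => <- <- <-.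
by apply/rowP=> -[[|[|[|m]]] i] //; rewrite !mxE.
Qed.

Lemma on_curve_vec3 x y z :
  on_curve c (vec3 x y z) = (y * z * (y + c * z + x) == x ^+ 3).
Proof.
have [xE yE zE] := vec3E x y z; rewrite /on_curve xE yE zE.
by congr (_ == _); ring.
Qed.

(** Points with nonzero [x], scaled to [x = a]; then [y + c z + x] becomes [a - s - t]. *)
Definition affine_reps : {set 'rV[F]_3} :=
  [set vec3 a (- t.1) (- t.2 / c) | t in split_pairs a b].

(** At [x = 0] the equation reads [y z (y + c z) = 0], one point per factor. *)
Definition reps_at_x0 : {set 'rV[F]_3} :=
  [set v in [:: vec3 0 1 0; vec3 0 0 1; vec3 0 (- c) 1]].

Lemma card_curve_points : #|curve_points c| = (#|split_pairs a b| + 3)%N.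
Proof.
have -> : (#|split_pairs a b| + 3)%N = #|affine_reps :|: reps_at_x0|.
  have dis : [disjoint affine_reps & reps_at_x0].
    apply/pred0P=> v /=; apply/negP=> /andP[/imsetP[t _ ->]].
    rewrite !inE => /or3P[] /eqP/vec3_inj[aE _ _];
      by move: a0; rewrite aE eqxx.
  rewrite cardsU (disjoint_setI0 dis) cards0 subn0; congr (_ + _)%N.
    rewrite card_imset // => -[s t] [s' t'] /vec3_inj[_ /oppr_inj /= -> ].
    by move/(mulIf (invr_neq0 c0))/oppr_inj ->.
  rewrite card_set_seq /= !inE.
  have [/vec3_inj[_ _ /eqP]|_] := eqVneq; first by rewrite eq_sym oner_eq0.
  have [/vec3_inj[_ _ /eqP]|_] := eqVneq; first by rewrite eq_sym oner_eq0.
  have [/vec3_inj[_ /eqP]|_] := eqVneq; last by [].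
  by rewrite eq_sym oppr_eq0 (negPf c0).
apply: card_equivalence_partition; first exact: proportional_equivalence.
(* Representatives lie on the curve: multiplied by [c], the equation at [x = a] has right side
   [c a^3 = b]. *)
- apply/subsetP=> v; rewrite in_setU => /orP[/imsetP[[s t] + ->]|];
    rewrite !inE /=.
    move=> /eqP st; rewrite vec3_eq0 (negPf a0) on_curve_vec3 /=.
    rewrite -(inj_eq (mulfI c0)) -cE -st; apply/eqP; field.
    by rewrite c0.
  case/or3P=> /eqP ->; rewrite vec3_eq0 on_curve_vec3 ?oner_eq0 ?andbF /=;
    by apply/eqP; ring.
- move=> v; rewrite inE (vec3_eta v) => /andP[].
  move: (v 0 0) (v 0 1) (v 0 2) => x y z {v}.
  rewrite vec3_eq0 on_curve_vec3.
  have prop (k : F) (u w : 'rV[F]_3) : k != 0 -> w = k *: u ->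
      w \in affine_reps :|: reps_at_x0 ->
      exists2 w, w \in affine_reps :|: reps_at_x0 & proportional u w.
    move=> k0 wE wW; exists w => //; apply/existsP; exists k.
    by rewrite k0 wE /=.
  have [->|x0] := eqVneq x 0; last first.
    (* Scaling by [a / x] makes the first coordinate [a]; [s] and [t] are read off the other two. *)
    move=> _ /eqP E; apply: (prop (a / x) _ _ _ erefl).
      by rewrite mulf_neq0 // invr_eq0.
    rewrite in_setU; apply/orP; left; apply/imsetP.
    exists (- (a / x * y), - c * (a / x * z)).
      rewrite inE /= cE -subr_eq0.
      have -> : (a - - (a / x * y) - - c * (a / x * z)) * - (a / x * y) *
        (- c * (a / x * z)) - c * a ^+ 3 =
        c * (a / x) ^+ 3 * (y * z * (y + c * z + x) - x ^+ 3) by field.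
      by rewrite E subrr mulr0.
    rewrite scale_vec3 divfK //=; congr vec3; first by ring.
    by field; rewrite c0 x0.
  rewrite expr0n /= addr0 !mulf_eq0.
  have [->|y0] /= := eqVneq y 0.
    move=> z0 _; apply: (prop z^-1 _ (vec3 0 0 1)); rewrite ?invr_eq0 //.
      by rewrite scale_vec3 !mulr0 mulVf.
    by rewrite !inE eqxx !orbT.
  have [->|z0] /= := eqVneq z 0.
    move=> _ _; apply: (prop y^-1 _ (vec3 0 1 0)); rewrite ?invr_eq0 //.
      by rewrite scale_vec3 !mulr0 mulVf.
    by rewrite !inE eqxx !orbT.
  rewrite addr_eq0 => _ /eqP yE.
  apply: (prop z^-1 _ (vec3 0 (- c) 1)); rewrite ?invr_eq0 //.
    by rewrite scale_vec3 yE mulr0 mulVf //; congr vec3; field.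
  by rewrite !inE eqxx !orbT.
(* Distinct representatives are not proportional: equal first coordinates [a] force [k = 1], the two
   families differ in whether [x] vanishes, and the last three points in which of [y], [z]
   vanish. *)
move=> v w vW wW /existsP[k /andP[k0 /eqP wE]].
case/setUP: vW wE => [/imsetP[[s t] _ ->]|];
  case/setUP: wW => [/imsetP[[s' t'] _ ->]|].
- rewrite scale_vec3 => E; have [/eqP + _ _] := vec3_inj E.
  by rewrite -subr_eq0 -{1}[a]mul1r -mulrBl mulf_eq0 subr_eq0 (negPf a0) orbF
    => /eqP k1; rewrite E -k1 !mul1r.
- rewrite !inE => /or3P[] /eqP->; rewrite scale_vec3 => /vec3_inj[/esym/eqP + _ _];
    by rewrite mulf_eq0 (negPf k0) (negPf a0).
- rewrite !inE => /or3P[] /eqP->; rewrite scale_vec3 => /vec3_inj[/eqP + _ _];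
    by rewrite mulr0 (negPf a0).
rewrite !inE => /or3P[] /eqP-> /or3P[] /eqP->; rewrite ?scale_vec3 => //;
 case/vec3_inj => _ /eqP + /eqP; rewrite ?mulr0 ?mulr1 ?oner_eq0 //.
- by move=> _; rewrite eq_sym (negPf k0).
- by rewrite eq_sym mulf_eq0 oppr_eq0 (negPf k0) (negPf c0).
by rewrite oppr_eq0 (negPf c0).
Qed.

End CurveCount.

(** * Roots of irreducible polynomials in finite extensions *)

Lemma irreducible_dvd_root (F : fieldType) (L : fieldExtType F)
    (p g : {poly F}) (z : L) :
  irreducible_poly p -> root (map_poly (in_alg L) p) z ->
  root (map_poly (in_alg L) g) z -> p %| g.
Proof.
move=> irr pz gz; have [cop|] := irredp_XsubCP irr (dvdp_gcdl p g); last first.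
  by move/eqp_dvdl <-; apply: dvdp_gcdr.
(* Coprimality survives extension of scalars, so it excludes the common root [z]. *)
move: cop; rewrite gcdp_eqp1 -(coprimep_map (in_alg L)) => /coprimep_root.
by move/(_ z pz); rewrite -rootE gz.
Qed.

Section FieldExtension.

Variables (F : finFieldType) (L : fieldExtType F).
Local Notation K := (finvect_type L).
Local Notation "p ^L" := (map_poly (in_alg K) p) (at level 2, format "p ^L").

Lemma card_finvect : #|K| = (#|F| ^ \dim {:L})%N.
Proof. by rewrite -(card_vspace (T := K) {:K}%VS) card_vspacef. Qed.

Lemma root_genPoly n (x : K) :
  \dim {:L} = n -> root ('X^(#|F| ^ n) - 'X : {poly F})^L x.
Proof.
move=> <-; rewrite rmorphB /= map_polyXn map_polyX rootE !hornerE -card_finvect.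
by rewrite expf_card subrr.
Qed.

End FieldExtension.

(** Adjoining a root of [f] gives a field all of whose elements are roots of the right-hand
    polynomial. The divisibility itself lives over [F], so it serves in any other extension. *)
Lemma irreducible_dvd_genPoly (F : finFieldType) (f : {poly F}) :
  irreducible_poly f -> f %| 'X^(#|F| ^ (size f).-1) - 'X.
Proof.
move=> irr; have [L dimL [z rz _]] := irredp_FAdjoin irr.
exact: irreducible_dvd_root irr rz (@root_genPoly F L _ z dimL).
Qed.

Section FieldExtension.

Variables (F : finFieldType) (L : fieldExtType F).
Local Notation K := (finvect_type L).
Local Notation "p ^L" := (map_poly (in_alg K) p) (at level 2, format "p ^L").
Local Notation G := ('Gal({:K} / 1%VS)%g).

(** Over [K], [f] divides the product of all [X - x], so it splits into distinct linear factors. *)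
Lemma card_roots_irreducible (f : {poly F}) :
  irreducible_poly f -> \dim {:L} = (size f).-1 ->
  #|[set x : K | root f^L x]| = (size f).-1.
Proof.
move=> irr dimL.
have : f^L %| \prod_(x : K) ('X - x%:P).
  rewrite -finField_genPoly card_finvect dimL.
  have -> : 'X^(#|F| ^ (size f).-1) - 'X = ('X^(#|F| ^ (size f).-1) - 'X)^L.
    by rewrite rmorphB /= map_polyXn map_polyX.
  by rewrite dvdp_map irreducible_dvd_genPoly.
rewrite -big_enum => /dvdp_prod_XsubC[m fE].
set s := mask m _ in fE.
have -> : [set x : K | root f^L x] = [set x in s].
  by apply/setP=> x; rewrite !inE (eqp_root fE) root_prod_XsubC.
rewrite cardsE (card_uniqP _) ?mask_uniq ?enum_uniq //.
by move/eqp_size: fE; rewrite size_map_poly size_prod_XsubC => ->.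
Qed.

(** * The characteristic polynomial of an element over [F] *)

Definition galCharPoly (x : K) : {poly K} := \prod_(g in G) ('X - (g x)%:P).

Lemma galois1 : galois 1%VS {:K}.
Proof. exact/finField_galois/sub1v. Qed.

Lemma card_Gal : #|G| = \dim {:L}.
Proof. by rewrite -(galois_dim galois1) dimv1 divn1. Qed.

Lemma gal_alg (g : gal_of {:K}) (y : F) : g \in G -> g y%:A = y%:A.
Proof. by move=> gG; rewrite (fixed_gal (sub1v _) gG) // memvZ // mem1v. Qed.

(** Each automorphism permutes the factors, so the coefficients lie in the fixed field of [G]. *)
Lemma galCharPoly_over x : exists f : {poly F}, f^L = galCharPoly x.
Proof.
suff /polyOver1P[f ->] : galCharPoly x \is a polyOver 1%VS by exists f.
apply/polyOverP=> i; rewrite -(galois_fixedField galois1).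
apply/fixedFieldP; first exact: memvf.
move=> h hG; rewrite -coef_map; congr ((polyseq _)`_i).
rewrite /galCharPoly rmorph_prod /= [RHS](reindex_inj (mulIg h)) /=.
apply: eq_big => g; first by rewrite groupMr.
by move=> gG; rewrite rmorphB /= map_polyX map_polyC /= galM ?memvf.
Qed.

Lemma galCharPolyE x :
  galCharPoly x = \prod_(y <- [seq (g : gal_of {:K}) x | g in G]) ('X - y%:P).
Proof. by rewrite big_image. Qed.

Lemma size_galCharPoly x : size (galCharPoly x) = (\dim {:L}).+1.
Proof. by rewrite galCharPolyE size_prod_XsubC size_image card_Gal. Qed.

Lemma monic_galCharPoly x : galCharPoly x \is monic.
Proof. by rewrite galCharPolyE monic_prod_XsubC. Qed.

Lemma coef0_galCharPoly x :
  (galCharPoly x)`_0 = (-1) ^+ (\dim {:L}) * galNorm 1%VS {:K} x.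
Proof.
by rewrite galCharPolyE coef0_prod_XsubC size_image card_Gal big_image.
Qed.

Lemma coefPn_galCharPoly x :
  (galCharPoly x)`_(\dim {:L}).-1 = - galTrace 1%VS {:K} x.
Proof.
rewrite galCharPolyE -card_Gal -(size_image (fun g : gal_of {:K} => g x)).
rewrite coefPn_prod_XsubC ?big_image //.
by rewrite size_image -lt0n cardG_gt0.
Qed.

Lemma root_galCharPoly x y :
  root (galCharPoly x) y = [exists g in G, y == (g : gal_of {:K}) x].
Proof.
rewrite galCharPolyE root_prod_XsubC; apply/imageP/exists_inP.
  by case=> g gG ->; exists g.
by case=> g gG /eqP->; exists g.
Qed.

Lemma root_galCharPoly_self x : root (galCharPoly x) x.
Proof.
rewrite root_galCharPoly; apply/exists_inP; exists 1%g; first exact: group1.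
by rewrite gal_id.
Qed.

(** Automorphisms fix scalars, so a scalar is conjugate only to itself. *)
Lemma root_galCharPoly_scalar x (y : F) :
  root (galCharPoly x) y%:A -> x = y%:A.
Proof.
rewrite root_galCharPoly => /exists_inP[g gG /eqP].
by rewrite -{1}(gal_alg y gG) => /fmorph_inj.
Qed.

Lemma galTrace_scalar (y : F) :
  galTrace 1%VS {:K} y%:A = ((\dim {:L})%:R * y)%:A.
Proof.
rewrite /galTrace (eq_bigr (fun _ => y%:A)) => [|g /gal_alg-> //].
by rewrite sumr_const card_Gal mulr_natl scalerMnl.
Qed.

Lemma galNorm_scalar (y : F) : galNorm 1%VS {:K} y%:A = (y ^+ \dim {:L})%:A.
Proof.
rewrite /galNorm (eq_bigr (fun _ => y%:A)) => [|g /gal_alg-> //].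
by rewrite prodr_const card_Gal -(rmorphXn (in_alg K)).
Qed.

(** * Elements of trace [a] and norm [b] in a cubic extension *)

Hypothesis dimL : \dim {:L} = 3%N.
Variables (a b : F).

(** Trace and norm are, up to sign, the [X^2] and constant coefficients; the free [X] coefficient is
    [u]. *)
Lemma galCharPoly_cubic x :
  reflect (exists u, galCharPoly x = (cubic a b u)^L)
    ((galTrace 1%VS {:K} x == a%:A) && (galNorm 1%VS {:K} x == b%:A)).
Proof.
have tr := coefPn_galCharPoly x; have no := coef0_galCharPoly x.
rewrite dimL /= in tr no.
apply: (iffP andP) => [[/eqP trE /eqP noE]|[u E]]; last first.
  rewrite E !coef_map cubicE !coef_Poly /= in tr no.
  split; first by rewrite -[galTrace _ _ _]opprK -tr scaleNr opprK.
  apply/eqP/oppr_inj; rewrite -scaleNr no; ring.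
have [f fE] := galCharPoly_over x; exists f`_1; rewrite -fE; congr _^L.
have sf : size f = 4%N.
  by rewrite -(size_map_poly (in_alg K)) fE size_galCharPoly dimL.
have mf : f \is monic by rewrite -(map_monic (in_alg K)) fE monic_galCharPoly.
have f0 : f`_0 = - b.
  apply: (fmorph_inj (in_alg K)); rewrite -coef_map fE no noE /= scaleNr; ring.
have f2 : f`_2 = - a.
  by apply: (fmorph_inj (in_alg K)); rewrite -coef_map fE tr trE /= scaleNr.
have f3 : f`_3 = 1 by move/monicP: mf; rewrite lead_coefE sf.
apply/polyP=> i; rewrite cubicE coef_Poly.
case: i => [|[|[|[|i]]]] //=.
by rewrite nth_default ?sf // nth_nil.
Qed.

(** The irreducible cubic divides the characteristic polynomial through the shared root [x]; both
    are monic of degree 3. *)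
Lemma root_irreducible_cubic u x :
  u \in irreducible_cubics a b -> root (cubic a b u)^L x ->
  galCharPoly x = (cubic a b u)^L.
Proof.
move=> /irreducible_cubicP irr rx; have [f fE] := galCharPoly_over x.
have rf : root f^L x by rewrite fE root_galCharPoly_self.
rewrite -fE; congr _^L; apply/eqP; rewrite eq_sym.
rewrite -eqp_monic ?cubic_monic //; last first.
  by rewrite -(map_monic (in_alg K)) fE monic_galCharPoly.
rewrite -dvdp_size_eqp ?(irreducible_dvd_root irr rx rf) // size_cubic.
by rewrite -(size_map_poly (in_alg K)) fE size_galCharPoly dimL.
Qed.

(** Elements are sorted by characteristic polynomial: an irreducible one accounts for its three
    roots, any other has a root in [F] and so comes from a scalar. *)
Lemma N3E : b != 0 ->
  N3 L a b = (3 * #|irreducible_cubics a b| + #|scalar_cube_roots a b|)%N.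
Proof.
move=> b0.
pose R u :=
  [set x : K | (u \in irreducible_cubics a b) && root (cubic a b u)^L x].
have RE u x : (x \in R u)
    = (u \in irreducible_cubics a b) && root (cubic a b u)^L x by rewrite in_set.
pose S := [set (y%:A : K) | y in scalar_cube_roots a b].
have E : [set x : K | [&& x != 0, galTrace 1%VS {:K} x == a%:A
                          & galNorm 1%VS {:K} x == b%:A]]
    = (\bigcup_u R u) :|: S.
  apply/setP=> x; rewrite inE; apply/and3P/setUP => [[_ trx nox]|].
    have [|u uE] := galCharPoly_cubic x _; first by rewrite trx.
    have rx : root (cubic a b u)^L x by rewrite -uE root_galCharPoly_self.
    have [irr|] := boolP (u \in irreducible_cubics a b).
      by left; apply/bigcupP; exists u; rewrite // inE irr.
    rewrite inE => /set0Pn[y]; rewrite inE => ry; right.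
    have xE : x = y%:A.
      by apply: root_galCharPoly_scalar; rewrite uE (fmorph_root (in_alg K)).
    apply/imsetP; exists y => //; rewrite inE.
    move: trx nox; rewrite xE galTrace_scalar galNorm_scalar dimL.
    by rewrite !(inj_eq (fmorph_inj (in_alg K))) => -> ->.
  have nz x' : galNorm 1%VS {:K} x' == b%:A -> x' != 0.
    apply: contraTneq => ->; rewrite galNorm0 eq_sym.
    by rewrite (fmorph_eq0 (in_alg K)).
  case=> [/bigcupP[u _]|/imsetP[y]]; rewrite inE.
    move=> /andP[irr rx]; have uE := root_irreducible_cubic irr rx.
    have [|trx nox] := andP (introT (galCharPoly_cubic x) _); first by exists u.
    by rewrite nz.
  move=> /andP[ty ny] ->.
  have ny' : galNorm 1%VS {:K} y%:A == b%:A.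
    by rewrite galNorm_scalar dimL (inj_eq (fmorph_inj (in_alg K))).
  by rewrite nz // galTrace_scalar dimL (inj_eq (fmorph_inj (in_alg K))).
rewrite /N3 E cardsU (_ : _ :&: S = set0) ?cards0 ?subn0; last first.
  apply/setP=> x; rewrite !inE; apply/negP=> /andP[/bigcupP[u _]].
  rewrite inE => /andP[irr rx] /imsetP[y _ xE]; move: rx irr.
  rewrite xE (fmorph_root (in_alg K)) inE => ry /eqP/setP/(_ y).
  by rewrite !inE ry.
rewrite card_imset; last exact: (fmorph_inj (in_alg K)).
(* The sets [R u] are disjoint, as [x] determines its characteristic polynomial and thereby [u]. *)
congr (_ + _)%N; rewrite -sum1_card partition_disjoint_bigcup /=; last first.
  move=> u v; apply: contraNT => /pred0Pn[x] /andP[].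
  rewrite /= !RE => /andP[iu ru] /andP[iv rv]; apply/eqP.
  apply: (cubic_inj (a := a) (b := b)).
  apply: (map_poly_inj (in_alg K)).
  by rewrite -(root_irreducible_cubic iu ru) -(root_irreducible_cubic iv rv).
rewrite mulnC -sum_nat_const [RHS]big_mkcond /=; apply: eq_bigr => u _.
rewrite sum1_card; case: ifP => iu.
  have irr : irreducible_poly (cubic a b u) by apply/irreducible_cubicP.
  rewrite -[RHS]/(4.-1)%N -(size_cubic a b u).
  rewrite -(card_roots_irreducible irr) ?size_cubic //.
  by apply: eq_card => x; rewrite RE iu inE.
by apply: eq_card0 => x; rewrite RE iu.
Qed.

End FieldExtension.

Theorem theorem5p1 (p r : nat) (F : finFieldType) (L : fieldExtType F)
    (a b : F) :
  prime p -> #|F| = (p ^ r)%N -> \dim {:L} = 3%N -> a != 0 -> b != 0 ->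
  let c := b * a ^- 3 in
  let eps : nat := if (p != 3%N) && (c == 27%:R^-1) then 1%N else 0%N in
  N3 L a b = #|curve_points c| /\
  (P3 a b)%:R = 3%:R^-1 * (#|curve_points c|%:R - eps%:R) :> rat.
Proof.
move=> p_pr oF dimL a0 b0 c eps.
have c0 : c != 0 by rewrite mulf_neq0 // invr_eq0 expf_neq0.
have cE : b = c * a ^+ 3 by rewrite divfK // expf_neq0.
have epsE : #|scalar_cube_roots a b| = eps.
  exact: card_scalar_cube_roots p_pr oF a0.
(* Both sides equal the number of triples plus 3. *)
have curveE : #|curve_points c| = (3 * #|irreducible_cubics a b| + eps)%N.
  by rewrite -epsE card_irreducible_cubics // -(card_curve_points a0 c0 cE).
rewrite (N3E dimL a b0) epsE curveE P3E; split=> //.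
by rewrite natrD addrK natrM mulKf.
Qed.
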